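(* For an integer $g\geq 3$ let $\mathcal{R} = \bigoplus_j\mathcal{R}_{(j)}$ be the ring attached to $g$ as in the context. For all $g\geq 9$ we have $\mathcal{R}_{(g-4)}=0$. For all $g\geq 12$ we have $\mathcal{R}_{(g-5)}=0$.
   Context: Fix an integer $g \geq 3$. Let $R := \mathbb{Q}[x_1,x_2,\ldots]$ be the polynomial ring in infinitely many variables, with gradings (additive on monomials) $\mathrm{codim}(x_i) = i$, level $\ell(x_i) = i-1$. Let $R^i_{(j)}$ be the $\mathbb{Q}$-span of monomials with $\mathrm{codim} = i$ and $\ell = j$; $R^i := \bigoplus_j R^i_{(j)}$, $\mathrm{Fil}^1 R^g := \bigoplus_{j \geq 1} R^g_{(j)}$, $R^{>g} := \bigoplus_{i>g} R^i$. Define the operator $$\mathcal{D} := -g\,\partial_1 + \tfrac12 \sum_{m,n\geq 1} \binom{m+n}{n} x_{m+n-1}\,\partial_m\partial_n, \qquad \partial_k := \partial/\partial x_k .$$ Let $I \subset R$ be the smallest $\mathbb{Q}$-linear subspace that is stable under $\mathcal{D}$ and contains $R^{>g} + \mathrm{Fil}^1 R^g$; explicitly $I = R^{>g} \oplus \sum_{n\geq 0}\mathcal{D}^n(\mathrm{Fil}^1 R^g)$. It is known (Polishchuk) that $I$ is an ideal of $R$. Put $\mathcal{R} := R/I$ with the induced bigrading $\mathcal{R} = \bigoplus \mathcal{R}^i_{(j)}$, and $\mathcal{R}_{(j)} := \bigoplus_i \mathcal{R}^i_{(j)}$. *)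

(* Defs.v *)
From HB Require Import structures.
From mathcomp Require Import all_boot all_order all_algebra.
From mathcomp Require Import finmap boolp monalg.

Set Implicit Arguments.
Unset Strict Implicit.
Unset Printing Implicit Defensive.

Import GRing.Theory.
Local Open Scope fset_scope.
Local Open Scope ring_scope.
Local Open Scope quotient_scope.

(* Monomials in x_1, x_2, ...: the generator of index [i : nat] is x_(i.+1),
   so the exponent of x_k in [u] is [u k.-1].  The functions [X] and [pd] below
   take the 1-based index k; their value at k = 0 is junk and never used. *)
Notation monom := {cmonom nat}.

Definition codim (u : monom) : nat := (\sum_(i <- finsupp u) u i * i.+1)%N.
Definition level (u : monom) : nat := (\sum_(i <- finsupp u) u i * i)%N.

Notation PR := {malg rat[monom]}.

Definition X (k : nat) : PR := << ucm k.-1 >>.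

(* The partial derivative with respect to x_k. *)
Definition pd (k : nat) (f : PR) : PR :=
  \sum_(u <- msupp f) << f@_u * (u k.-1)%:R *g divcm u (ucm k.-1) >>.

(* The largest k such that x_k occurs in f (0 if f is constant). *)
Definition nvars (f : PR) : nat :=
  (\max_(u <- msupp f) \max_(i <- finsupp u) i.+1)%N.

Lemma pd_eq0 (k : nat) (f : PR) : (nvars f < k)%N -> pd k f = 0.
Proof.
case: k => // k lt_fk; rewrite /pd big1_seq //= => u uf.
suff -> : u k = 0%N by rewrite mulr0 monalgU0.
apply/eqP; rewrite cmE_eq0; apply: contraL lt_fk => ku.
rewrite -leqNgt; apply: leq_trans (leq_bigmax_seq _ uf isT).
exact: leq_trans (leq_bigmax_seq _ ku isT).
Qed.

(* The sum over all m, n >= 1 is cut off at [nvars f], beyond which the terms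
   vanish by [pd_eq0]. *)
Definition Dop (g : nat) (f : PR) : PR :=
  - (g%:R *: pd 1 f)
  + 2%:R^-1 *: \sum_(1 <= m < (nvars f).+1) \sum_(1 <= n < (nvars f).+1)
      'C(m + n, n)%:R *: (X (m + n - 1) * pd m (pd n f)).

Definition monspan (P : pred monom) (f : PR) : Prop :=
  forall u, u \in msupp f -> P u.

Definition Rbi (i j : nat) : PR -> Prop :=
  monspan [pred u | (codim u == i) && (level u == j)].
Definition Rgt (g : nat) : PR -> Prop := monspan [pred u | (g < codim u)%N].
Definition Fil1 (g : nat) : PR -> Prop :=
  monspan [pred u | (codim u == g) && (1 <= level u)%N].

Definition subspace (S : PR -> Prop) : Prop :=
  S 0 /\ forall (a : rat) f h, S f -> S h -> S (a *: f + h).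

Definition in_I (g : nat) (f : PR) : Prop :=
  forall S : PR -> Prop, subspace S ->
    (forall h, S h -> S (Dop g h)) ->
    (forall a b, Rgt g a -> Fil1 g b -> S (a + b)) ->
    S f.

Definition Ipred (g : nat) : {pred PR} := fun f => `[< in_I g f >].

Lemma Ipred_submod g : submod_closed (Ipred g).
Proof.
split=> [|a f h]; first by apply/asboolP => S [S0].
move=> /asboolP If /asboolP Ih; apply/asboolP => S sS sD sI.
by case: (sS) => _ SZ; apply: SZ; [apply: If|apply: Ih].
Qed.

HB.instance Definition _ g :=
  GRing.isSubmodClosed.Build rat PR (Ipred g) (Ipred_submod g).

(* The quotient R/I as a Q-vector space. *)
Definition calR (g : nat) := Quotient.quot (Ipred g).
HB.instance Definition _ g := GRing.Zmodule.on (calR g).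

Definition cls (g : nat) (f : PR) : calR g := \pi_(Quotient.quot (Ipred g)) f.

Lemma cls_eq g f h : (cls g f = cls g h) <-> (f - h \in Ipred g).
Proof. by rewrite /cls (Quotient.idealrBE (Ipred g)); split=> /eqP. Qed.

Lemma cls_zmod g : zmod_morphism (cls g).
Proof. exact: raddfB. Qed.
HB.instance Definition _ g :=
  GRing.isZmodMorphism.Build PR (calR g) (cls g) (@cls_zmod g).

Definition calR_scale g (a : rat) (z : calR g) : calR g :=
  cls g (a *: repr (z : Quotient.quot (Ipred g))).

Lemma cls_repr g (z : calR g) : cls g (repr (z : Quotient.quot (Ipred g))) = z.
Proof. exact: reprK. Qed.

Lemma cls_scale g a f : calR_scale a (cls g f) = cls g (a *: f).
Proof.
apply/cls_eq; rewrite -scalerBr; apply: rpredZ.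
by apply/cls_eq; rewrite cls_repr.
Qed.

Fact calR_scaleA g a b (z : calR g) :
  calR_scale a (calR_scale b z) = calR_scale (a * b) z.
Proof. by rewrite -(cls_repr z) !cls_scale scalerA. Qed.
Fact calR_scale1 g : left_id 1 (@calR_scale g).
Proof. by move=> z; rewrite -(cls_repr z) cls_scale scale1r. Qed.
Fact calR_scaleDr g : right_distributive (@calR_scale g) +%R.
Proof.
move=> a z t; rewrite -(cls_repr z) -(cls_repr t).
by rewrite -raddfD !cls_scale scalerDr raddfD.
Qed.
Fact calR_scaleDl g (z : calR g) :
  {morph (@calR_scale g)^~ z : a b / a + b}.
Proof. by move=> a b; rewrite -(cls_repr z) !cls_scale scalerDl raddfD. Qed.

HB.instance Definition _ g := GRing.Zmodule_isLmodule.Build rat (calR g)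
  (@calR_scaleA g) (@calR_scale1 g) (@calR_scaleDr g) (@calR_scaleDl g).

(* The induced bigrading: the bihomogeneous piece of codimension i and level j
   is the image of [Rbi i j], and the level-j piece is the sum of these over
   all i. *)
Definition calR_bi (g i j : nat) (z : calR g) : Prop :=
  exists2 f, Rbi i j f & z = cls g f.

Definition calR_level (g j : nat) (z : calR g) : Prop :=
  exists (n : nat) (t : nat -> calR g),
    (forall i, (i < n)%N -> calR_bi i j (t i)) /\ z = \sum_(i < n) t i.

(* Main.v *)
(** Put z_p = (p+1)! x_(p+1).  Then D is the second order operator
    D(z_p f) = z_p D f - [p = 0] g f + B_p f, where B_p is the derivation with
    B_p z_q = (p+q+2) z_(p+q): it merges two factors and keeps the level.
    Monomials of level j = g - e and codimension at least g are those of degree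
    at least e, so I is reached downwards from degree e.  If all monomials of
    degree d and level j are in I, applying D to z_0^(r+1) P, with P a product
    of s = d - r - 1 factors z_p, p > 0, gives modulo I
      (r+1) (2s + r - e) z_0^r P = - z_0^(r+1) D P.
    By induction on s this kills all products with 2s + r < e.  When d = e it
    makes all products z_0^r P nonzero multiples of z_0^(e-2) z_j, and the
    relation for r = -1 then kills that one too.  There remains the coefficient
    2s + r - e = 0, s = 2, met for (e, d) = (4, 3) and (5, 4).  There the products of
    three (resp. four) factors z_p, p > 0, give linear relations between the
    z_0^r z_c z_(j-c); a solution of the dual system is, after rescaling, affine
    (resp. quadratic) in c, and the symmetry c <-> j - c forces it to vanish
    when j >= 5 (resp. j >= 7). *)

Require Import Defs.
From HB Require Import structures.
From mathcomp Require Import all_boot all_order all_algebra.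
From mathcomp Require Import finmap boolp monalg.
From mathcomp Require Import zify ring lra.

Set Implicit Arguments.
Unset Strict Implicit.
Unset Printing Implicit Defensive.

Import GRing.Theory Num.Theory.
Local Open Scope fset_scope.
Local Open Scope ring_scope.
Local Open Scope quotient_scope.

(** * The linear systems *)

(* A linear functional on the span of [x :: S], nonzero at x: it reduces linear
   systems with unknowns in a rational vector space to rational unknowns. *)
Lemma separation (V : lmodType rat) (x : V) (S : seq V) : x != 0 ->
  exists2 phi : V -> rat, phi x = 1 &
    forall w : seq (rat * V), {subset [seq p.2 | p <- w] <= x :: S} ->
      \sum_(p <- w) p.1 *: p.2 = 0 -> \sum_(p <- w) p.1 * phi p.2 = 0.
Proof.
move=> x0; elim: S => [|y S [phi phix Hphi]].
  exists (fun=> 1) => // w sub; rewrite big_seq.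
  have E p : p \in w -> p.1 *: p.2 = p.1 *: x.
    by move=> pw; have := sub _ (map_f snd pw); rewrite inE => /eqP ->.
  rewrite (eq_bigr _ E) -big_seq -scaler_suml => /eqP.
  by rewrite scaler_eq0 (negPf x0) orbF -mulr_suml => /eqP ->; rewrite mul0r.
have [yxS|yxS] := boolP (y \in x :: S).
  exists phi => // w sub; apply: Hphi => v /sub.
  by rewrite !inE orbCA => /predU1P[->|//]; rewrite inE in yxS.
have split_sum (W : lmodType rat) (f : V -> W) (w : seq (rat * V)) :
    \sum_(p <- w) p.1 *: f p.2 = (\sum_(p <- w | p.2 == y) p.1) *: f y
      + \sum_(p <- [seq p <- w | p.2 != y]) p.1 *: f p.2.
  rewrite (bigID (fun p => p.2 == y)) /= big_filter scaler_suml.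
  by congr (_ + _); apply: eq_bigr => p /eqP ->.
have sub0 (w : seq (rat * V)) : {subset [seq p.2 | p <- w] <= [:: x, y & S]} ->
    {subset [seq p.2 | p <- [seq p <- w | p.2 != y]] <= x :: S}.
  move=> sub v /mapP[p]; rewrite mem_filter => /andP[py pw ->].
  have := sub _ (map_f snd pw); rewrite !inE.
  by rewrite (negPf py).
have xy : x == y = false by apply: contraNF yxS => /eqP ->; rewrite inE eqxx.
pose ext (c : rat) v := if v == y then c else phi v.
have extE c (w : seq (rat * V)) : \sum_(p <- w) p.1 * ext c p.2 =
    (\sum_(p <- w | p.2 == y) p.1) * c
    + \sum_(p <- [seq p <- w | p.2 != y]) p.1 * phi p.2.
  rewrite (split_sum rat^o) /ext eqxx; congr (_ + _); rewrite !big_filter.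
  by apply: eq_bigr => p /negPf ->.
have [[u [usub uy]]|nspan] := pselect (exists u : seq (rat * V),
    {subset [seq p.2 | p <- u] <= x :: S} /\ \sum_(p <- u) p.1 *: p.2 = y).
  exists (ext (\sum_(p <- u) p.1 * phi p.2)); first by rewrite /ext xy.
  move=> w sub; rewrite extE (split_sum V id) -{2}uy; set c := \sum_(p <- w | _) _.
  move=> E; pose w' := [seq (c * p.1, p.2) | p <- u] ++ [seq p <- w | p.2 != y].
  apply: (etrans _ (Hphi w' _ _)).
  - rewrite /w' big_cat big_map /= mulr_sumr; congr (_ + _).
    by apply: eq_bigr => p _; rewrite mulrA.
  - move=> v; rewrite map_cat mem_cat => /orP[|/sub0 -> //].
    by rewrite -map_comp => /usub.
  rewrite /w' big_cat big_map /=; apply: etrans E; rewrite scaler_sumr; congr (_ + _).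
  by apply: eq_bigr => p _; rewrite scalerA.
exists (ext 0); first by rewrite /ext xy.
move=> w sub; rewrite extE (split_sum V id) mulr0 add0r.
set c := \sum_(p <- w | _) _ => E.
have c0 : c = 0.
  apply/eqP; apply: contra_notT nspan => c0.
  exists [seq (- c^-1 * p.1, p.2) | p <- [seq p <- w | p.2 != y]]; split.
    by rewrite -map_comp; exact: sub0.
  rewrite big_map; apply: (scalerI c0); rewrite scaler_sumr.
  rewrite -[RHS]addr0 -[in RHS](subrr (\sum_(p <- [seq p <- w | p.2 != y]) p.1 *: p.2)).
  rewrite addrA E sub0r -sumrN; apply: eq_bigr => p _ /=.
  by rewrite scalerA mulrA mulrN divff // mulN1r scaleNr.
by apply: Hphi; [exact: sub0|move: E; rewrite c0 scale0r add0r].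
Qed.

(* [merge3] is the value of D on z_a z_b z_c when f c stands for z_c z_(j-c),
   and [merge4] that of D^2 on z_a z_b z_c z_d. *)
Section Merges.

Variables (W : lmodType rat) (f : nat -> W).

Definition merge3 (a b c : nat) : W :=
  (a + b + 2)%:R *: f (a + b)%N + (a + c + 2)%:R *: f (a + c)%N
  + (b + c + 2)%:R *: f (b + c)%N.

Definition merge4 (a b c d : nat) : W :=
  (a + b + 2)%:R *: merge3 (a + b) c d + (a + c + 2)%:R *: merge3 (a + c) b d
  + (a + d + 2)%:R *: merge3 (a + d) b c + (b + c + 2)%:R *: merge3 (b + c) a d
  + (b + d + 2)%:R *: merge3 (b + d) a c + (c + d + 2)%:R *: merge3 (c + d) a b.

End Merges.

(** By symmetry the relation reads F a + F b + F c = 0 with [F c] = (j + 2 - c) v c. Trading the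
    pair (1, k+2) for (2, k+1) makes [F] affine on 1..j-2; the triple (1, 1, j-2) and v (j-2) = v 2
    then leave (j-4)(j+3) dl = 0. *)
Lemma three_part_kernel (v : nat -> rat) (j : nat) : (4 < j)%N ->
    (forall c, (0 < c < j)%N -> v (j - c)%N = v c) ->
    (forall a b c, (0 < a)%N -> (0 < b)%N -> (0 < c)%N -> (a + b + c = j)%N ->
      merge3 (v : nat -> rat^o) a b c = 0) ->
  forall c, (0 < c < j)%N -> v c = 0.
Proof.
move=> j4 sym rel; pose J : rat := j%:R; pose F c := (J + 2 - c%:R) * v c.
have relF a b c : (0 < a)%N -> (0 < b)%N -> (0 < c)%N -> (a + b + c = j)%N ->
    F a + F b + F c = 0.
  move=> a0 b0 c0 abc; have := rel _ _ _ a0 b0 c0 abc.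
  rewrite /merge3 /GRing.scale /=.
  have -> : (a + b = j - c)%N by lia.
  have -> : (a + c = j - b)%N by lia.
  have -> : (b + c = j - a)%N by lia.
  rewrite !sym ?natrD ?natrB; try lia.
  by rewrite /F -/J => E; lra.
pose dl := F 2%N - F 1%N.
have FE k : (k.+1 <= j - 2)%N -> F k.+1 = F 1%N + k%:R * dl.
  elim: k => [|k IHk] lt; first by rewrite mul0r addr0.
  have := relF 1%N k.+2 (j - 3 - k)%N; have := relF 2%N k.+1 (j - 3 - k)%N.
  move=> /(_ isT isT) E1 /(_ isT isT) E2.
  have {}E1 := E1 ltac:(lia) ltac:(lia).
  have {}E2 := E2 ltac:(lia) ltac:(lia).
  have {}IHk := IHk ltac:(lia).
  by move: E1 E2; rewrite -natr1 mulrDl mul1r {2}/dl IHk; lra.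
have J5 : 5 <= J by rewrite ler_nat.
have Fj : F (j - 2)%N = F 1%N + (J - 3) * dl.
  have {1}-> : (j - 2 = (j - 3).+1)%N by lia.
  by rewrite FE ?natrB //; lia.
have E1 : 3 * F 1%N + (J - 3) * dl = 0.
  by have := relF 1%N 1%N (j - 2)%N isT isT ltac:(lia) ltac:(lia); rewrite Fj => ?; lra.
have E2 : 4 * (F 1%N + dl) = J * (F 1%N + (J - 3) * dl).
  rewrite -Fj /dl addrC subrK /F sym ?natrB; try lia.
  by rewrite -/J; ring.
have dl0 : dl = 0.
  have : (J - 4) * (J + 3) * dl = 0.
    have F1E : F 1%N = - (J - 3) / 3 * dl by lra.
    by move: E2; rewrite F1E; lra.
  by move/eqP; rewrite !mulf_eq0 => /orP[/orP[]|] /eqP ?; lra.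
have F10 : F 1%N = 0 by move: E1; rewrite dl0; lra.
have v0 c : (0 < c <= j - 2)%N -> v c = 0.
  case: c => // c /andP[_ lt]; have /eqP := FE c lt.
  rewrite dl0 F10 mulr0 addr0 mulf_eq0 => /orP[/eqP|/eqP//].
  have : c.+1%:R <= J by rewrite ler_nat; lia.
  by lra.
(* A part of a triple never exceeds j - 2; the value at j - 1 is that at 1 by symmetry. *)
move=> c /andP[c0 cj]; have [lt|lt] := leqP c (j - 2); first by rewrite v0 ?c0.
by rewrite -sym ?c0 // v0 //; lia.
Qed.

(* Comparing (a+1,1,c,d) with (a,2,c,d) shows that G and H have constant, opposite
   second differences +dl and -dl; then [GH] at 2, 3, 4 gives G 1, G 2 and H 2 as
   multiples of dl, and the relation at (1,1,1,j-3) becomes (j+3)(j+4) dl = 0. *)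
Lemma quadratic_kernel (G H : nat -> rat) (j : nat) : (6 < j)%N ->
    (forall k, (0 < k < j)%N -> H (j - k)%N = H k) ->
    (forall k, (k%:R + 2) * G k = (j%:R - k%:R + 3) * H k) ->
    (forall a b c d, (0 < a)%N -> (0 < b)%N -> (0 < c)%N -> (0 < d)%N ->
      (a + b + c + d)%N = j ->
      G a + G b + G c + G d + H (a + b)%N + H (a + c)%N + H (a + d)%N = 0) ->
  forall k, (k + 4 <= j)%N -> G k.+1 = 0.
Proof.
move=> j6 Hsym GH relGH; have [J JE] : {J : rat | J = j%:R} by eexists.
have [dl dlE] : {dl | dl = G 3%N - G 2%N - (G 2%N - G 1%N)} by eexists.
have step a c : (0 < a)%N -> (0 < c)%N -> (a + c <= j - 3)%N ->
    G a.+1 - G a - (G 2%N - G 1%N) + (H (a + c).+1 - H (a + c)%N)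
    - (H c.+2 - H c.+1) = 0.
  move=> a0 c0 ac; pose d := (j - 2 - a - c)%N.
  have d0 : (0 < d)%N by rewrite /d; lia.
  have E1 := relGH a.+1 1%N c d isT isT c0 d0 ltac:(lia).
  have E2 := relGH a 2%N c d a0 isT c0 d0 ltac:(lia).
  have h1 : H (a.+1 + d)%N = H c.+1 by rewrite -Hsym; [congr H|]; lia.
  have h2 : H (a + d)%N = H c.+2 by rewrite -Hsym; [congr H|]; lia.
  rewrite addn1 addSn h1 in E1; rewrite addn2 h2 in E2.
  by lra.
(* For a = 2 the [G] part of [step] is [dl], which gives the differences of [H]; feeding them back
   with c = 1 gives those of [G]. *)
have hE k : (k + 5 <= j)%N -> H k.+3 - H k.+2 = H 3%N - H 2%N - k%:R * dl.
  elim: k => [|k IHk] lt; first by rewrite mul0r subr0.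
  have := step 2%N k.+1 isT isT ltac:(lia); have := IHk ltac:(lia).
  by rewrite !add2n [k.+1%:R]mulrS mulrDl mul1r; lra.
have gE k : (k + 5 <= j)%N -> G k.+2 - G k.+1 = G 2%N - G 1%N + k%:R * dl.
  move=> lt; have := step k.+1 1%N isT isT ltac:(lia); have := hE k ltac:(lia).
  by rewrite addn1; lra.
have GE k : (k + 4 <= j)%N ->
    G k.+1 = G 1%N + k%:R * (G 2%N - G 1%N) + k%:R * (k%:R - 1) / 2 * dl.
  elim: k => [|k IHk] lt; first by lra.
  have := gE k ltac:(lia); have := IHk ltac:(lia).
  by rewrite [k.+1%:R]mulrS; lra.
have HE k : (k + 4 <= j)%N ->
    H k.+2 = H 2%N + k%:R * (H 3%N - H 2%N) - k%:R * (k%:R - 1) / 2 * dl.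
  elim: k => [|k IHk] lt; first by rewrite !mul0r addr0 subr0.
  have := hE k ltac:(lia); have := IHk ltac:(lia).
  by rewrite [k.+1%:R]mulrS; lra.
have J7 : 7 <= J by rewrite JE ler_nat.
have h2E : H 3%N - H 2%N = (J - 5) / 2 * dl.
  have := HE (j - 4)%N ltac:(lia).
  have -> : ((j - 4).+2 = j - 2)%N by lia.
  have j4 : (4 <= j)%N by lia.
  rewrite (Hsym 2%N ltac:(lia)) (natrB _ j4) -JE.
  move=> E; apply: (@mulfI _ (J - 4)); first by lra.
  by lra.
have E0 : 4 * G 1%N + (J - 4) * (G 2%N - G 1%N) + (J - 4) * (J - 5) / 2 * dl
    + 3 * H 2%N = 0.
  have := relGH 1%N 1%N 1%N (j - 3)%N isT isT isT ltac:(lia) ltac:(lia).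
  have {1}-> : (j - 3 = (j - 4).+1)%N by lia.
  rewrite -[(1 + 1)%N]/2%N.
  have -> : H (1 + (j - 3))%N = H 2%N by rewrite -Hsym; [congr H|]; lia.
  have j4 : (4 <= j)%N by lia.
  by rewrite (GE (j - 4)%N ltac:(lia)) (natrB _ j4) -JE; lra.
have G3 := GE 2%N ltac:(lia); have G4 := GE 3%N ltac:(lia).
have H3 := HE 1%N ltac:(lia); have H4 := HE 2%N ltac:(lia).
rewrite -JE in GH.
have [GH2 GH3 GH4] := And3 (GH 2%N) (GH 3%N) (GH 4%N).
have g1E : G 2%N - G 1%N = - (J + 1) * dl.
  have G2 : G 2%N = G 1%N + (G 2%N - G 1%N) by rewrite addrC subrK.
  rewrite {}H3 {}G3 in GH3; rewrite {}G4 {}H4 in GH4; rewrite {1}G2 in GH2.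
  rewrite h2E in GH3 GH4; move: (G 2%N - _) GH2 GH3 GH4 => g1; lra.
have G1E : G 1%N = (J + 1) * (J + 2) / 2 * dl.
  have G2 : G 2%N = G 1%N + (G 2%N - G 1%N) by rewrite addrC subrK.
  rewrite {}H3 {}G3 h2E g1E in GH3; rewrite {1}G2 g1E in GH2.
  apply: (@mulfI _ (J + 5)); first by lra.
  (* The weights J and J + 1 give [H 2] the same coefficient in [GH2] and [GH3], so it is
     eliminated. *)
  have X2 : J * ((2 + 2) * (G 1%N - (J + 1) * dl)) = J * ((J - 2 + 3) * H 2%N).
    by congr (J * _); lra.
  have X3 : (J + 1) * ((3 + 2) * (G 1%N + 2 * (- (J + 1) * dl) + dl)) =
      (J + 1) * ((J - 3 + 3) * (H 2%N + (J - 5) / 2 * dl)).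
    by congr ((J + 1) * _); lra.
  by lra.
have H2E : H 2%N = 2 * J * dl.
  have G2 : G 2%N = G 1%N + (G 2%N - G 1%N) by rewrite addrC subrK.
  rewrite {1}G2 g1E G1E in GH2.
  by apply: (@mulfI _ (J + 1)); [lra|lra].
have dl0 : dl = 0.
  rewrite g1E G1E H2E in E0.
  have /eqP : (J + 3) * (J + 4) * dl = 0 by lra.
  by rewrite !mulf_eq0 => /orP[/orP[]|] /eqP ?; lra.
by move=> k kj; rewrite GE // g1E G1E dl0; ring.
Qed.

(** The terms leaving a alone have first merges adding up to (b+c+2) + (b+d+2) + (c+d+2) = 2
    (j-a+3), hence give 2 [G a]; merging {a,b} and {c,d} in either order gives 2 [H (a + b)]. So
    [merge4] is twice the left side of the relation in [quadratic_kernel]. *)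
Lemma four_part_kernel (v : nat -> rat) (j : nat) : (6 < j)%N ->
    (forall c, (0 < c < j)%N -> v (j - c)%N = v c) ->
    (forall a b c d, (0 < a)%N -> (0 < b)%N -> (0 < c)%N -> (0 < d)%N ->
      (a + b + c + d = j)%N -> merge4 (v : nat -> rat^o) a b c d = 0) ->
  forall c, (0 < c < j)%N -> v c = 0.
Proof.
move=> j6 sym rel; pose J : rat := j%:R.
pose G k := (J - k%:R + 2) * (J - k%:R + 3) * v k.
pose H k := (k%:R + 2) * (J - k%:R + 2) * v k.
have Hsym k : (0 < k < j)%N -> H (j - k)%N = H k.
  by move=> kj; rewrite /H sym // natrB -/J; [ring|lia].
have relGH a b c d : (0 < a)%N -> (0 < b)%N -> (0 < c)%N -> (0 < d)%N ->
    (a + b + c + d = j)%N ->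
    G a + G b + G c + G d + H (a + b)%N + H (a + c)%N + H (a + d)%N = 0.
  move=> a0 b0 c0 d0 abcd; have := rel _ _ _ _ a0 b0 c0 d0 abcd.
  have JE : J = a%:R + b%:R + c%:R + d%:R by rewrite /J -abcd !natrD.
  have va : v (b + c + d)%N = v a by rewrite -sym; [congr v|]; lia.
  have vb : v (a + c + d)%N = v b by rewrite -sym; [congr v|]; lia.
  have vc : v (a + b + d)%N = v c by rewrite -sym; [congr v|]; lia.
  have vd : v (a + b + c)%N = v d by rewrite -sym; [congr v|]; lia.
  have vab : v (c + d)%N = v (a + b)%N by rewrite -sym; [congr v|]; lia.
  have vac : v (b + d)%N = v (a + c)%N by rewrite -sym; [congr v|]; lia.
  have vad : v (b + c)%N = v (a + d)%N by rewrite -sym; [congr v|]; lia.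
  rewrite /merge4 /merge3.
  have -> : (a + c + b = a + b + c)%N by lia.
  have -> : (a + d + b = a + b + d)%N by lia.
  have -> : (a + d + c = a + c + d)%N by lia.
  have -> : (b + c + a = a + b + c)%N by lia.
  have -> : (b + d + a = a + b + d)%N by lia.
  have -> : (b + d + c = b + c + d)%N by lia.
  have -> : (c + d + a = a + c + d)%N by lia.
  have -> : (c + d + b = b + c + d)%N by lia.
  rewrite va vb vc vd vab vac vad => E; apply: (@mulfI _ 2) => //.
  rewrite mulr0 -{}E /G /H /GRing.scale /= JE !natrD.
  by ring.
have G0 : forall k, (k + 4 <= j)%N -> G k.+1 = 0.
  by apply: quadratic_kernel Hsym _ relGH => // k; rewrite /G /H -/J; ring.
have v0 c : (0 < c <= j - 3)%N -> v c = 0.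
  case: c => // c /andP[_ lt]; have /eqP := G0 c ltac:(lia).
  have : c.+1%:R <= J by rewrite ler_nat; lia.
  by rewrite !mulf_eq0 => ? /orP[/orP[]|/eqP//] /eqP; lra.
move=> c /andP[c0 cj]; have [lt|lt] := leqP c (j - 3); first by rewrite v0 ?c0.
by rewrite -sym ?c0 // v0 //; lia.
Qed.

(** * From rational unknowns to unknowns in a rational vector space *)

Section Transfer.

Variables (V : lmodType rat) (f : nat -> V) (j : nat).

(** If f c were nonzero, v would be a rational solution of the same relations and the same symmetry
    with v c = 1, contradicting the kernel lemmas. Relations are encoded as lists of pairs
    (coefficient, index). *)
Lemma functional_of_neq0 c : (0 < c < j)%N -> f c != 0 ->
  exists v : nat -> rat, [/\ v c = 1, forall k l, f k = f l -> v k = v l &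
    forall w : seq (rat * nat), all (fun p => 0 < p.2 < j)%N w ->
      \sum_(p <- w) p.1 *: f p.2 = 0 ->
      \sum_(p <- w) p.1 *: (v p.2 : rat^o) = 0].
Proof.
move=> cj fc; have [phi phic Hphi] := separation [seq f k | k <- iota 1 j.-1] fc.
exists (phi \o f); split=> //= [k l -> //|w /allP wj w0].
pose w' := [seq (p.1, f p.2) | p <- w]; have := Hphi w'; rewrite !big_map; apply=> //.
move=> y; rewrite -map_comp => /mapP[p /wj pj ->] /=; rewrite inE; apply/orP; right.
by rewrite map_f // mem_iota; lia.
Qed.

Definition mergeseq3 (a b c : nat) : seq (rat * nat) :=
  [:: ((a + b + 2)%:R, (a + b)%N); ((a + c + 2)%:R, (a + c)%N);
      ((b + c + 2)%:R, (b + c)%N)].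

Definition scaleseq (x : rat) (w : seq (rat * nat)) := [seq (x * p.1, p.2) | p <- w].

Definition mergeseq4 (a b c d : nat) : seq (rat * nat) :=
  scaleseq (a + b + 2)%:R (mergeseq3 (a + b) c d)
  ++ scaleseq (a + c + 2)%:R (mergeseq3 (a + c) b d)
  ++ scaleseq (a + d + 2)%:R (mergeseq3 (a + d) b c)
  ++ scaleseq (b + c + 2)%:R (mergeseq3 (b + c) a d)
  ++ scaleseq (b + d + 2)%:R (mergeseq3 (b + d) a c)
  ++ scaleseq (c + d + 2)%:R (mergeseq3 (c + d) a b).

Lemma sum_mergeseq3 (W : lmodType rat) (h : nat -> W) a b c :
  \sum_(p <- mergeseq3 a b c) p.1 *: h p.2 = merge3 h a b c.
Proof. by rewrite !big_cons big_nil addr0 addrA. Qed.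

Lemma sum_scaleseq (W : lmodType rat) (h : nat -> W) x w :
  \sum_(p <- scaleseq x w) p.1 *: h p.2 = x *: \sum_(p <- w) p.1 *: h p.2.
Proof. by rewrite big_map scaler_sumr; apply: eq_bigr => p _; rewrite scalerA. Qed.

Lemma sum_mergeseq4 (W : lmodType rat) (h : nat -> W) a b c d :
  \sum_(p <- mergeseq4 a b c d) p.1 *: h p.2 = merge4 h a b c d.
Proof. by rewrite !big_cat !sum_scaleseq !sum_mergeseq3 /= /merge4 !addrA. Qed.

Hypothesis sym : forall c, (0 < c < j)%N -> f (j - c)%N = f c.

Lemma three_part_vanish : (4 < j)%N ->
    (forall a b c, (0 < a)%N -> (0 < b)%N -> (0 < c)%N -> (a + b + c = j)%N ->
      merge3 f a b c = 0) ->
  forall c, (0 < c < j)%N -> f c = 0.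
Proof.
move=> j4 rel c cj; apply/eqP; apply: contraT => fc.
have [v [vc vf vw]] := functional_of_neq0 cj fc.
have : v c = 0; last by rewrite vc => /eqP; rewrite oner_eq0.
apply: (three_part_kernel j4) cj => [k /sym /vf //|a b d a0 b0 d0 abd].
rewrite -sum_mergeseq3; apply: vw; last by rewrite sum_mergeseq3 rel.
by rewrite /=; lia.
Qed.

Lemma four_part_vanish : (6 < j)%N ->
    (forall a b c d, (0 < a)%N -> (0 < b)%N -> (0 < c)%N -> (0 < d)%N ->
      (a + b + c + d = j)%N -> merge4 f a b c d = 0) ->
  forall c, (0 < c < j)%N -> f c = 0.
Proof.
move=> j6 rel c cj; apply/eqP; apply: contraT => fc.
have [v [vc vf vw]] := functional_of_neq0 cj fc.
have : v c = 0; last by rewrite vc => /eqP; rewrite oner_eq0.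
apply: (four_part_kernel j6) cj => [k /sym /vf //|a b d e a0 b0 d0 e0 abde].
rewrite -sum_mergeseq4; apply: vw; last by rewrite sum_mergeseq4 rel.
by rewrite /=; lia.
Qed.

End Transfer.

Lemma scaler_natl (A : lalgType rat) n (f : A) : n%:R *: f = n%:R * f.
Proof. by rewrite scaler_nat mulr_natl. Qed.

(** * The operator D on products of the z_p *)

Section Operators.

Variables (A : comAlgType rat) (x : nat -> A) (d : nat -> {linear A -> A}).
Hypothesis dxM : forall k i f, (0 < k)%N -> (0 < i)%N ->
  d k (x i * f) = (if k == i then f else 0) + x i * d k f.

Definition zvar (p : nat) : A := p.+1`!%:R * x p.+1.

(** The derivation B_p, cut off at N: the cross term of D with z_p. *)
Definition contract (N p : nat) (f : A) : A :=
  p.+1`!%:R * \sum_(1 <= m < N.+1) 'C(m + p.+1, p.+1)%:R * (x (m + p)%N * d m f).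

(** D with a free cut-off N. [Dop] cuts at [nvars f], which may change when f is multiplied by z_p,
    so comparing the two needs a common bound. *)
Definition lap (g N : nat) (f : A) : A :=
  - (g%:R *: d 1%N f)
  + 2%:R^-1 *: \sum_(1 <= m < N.+1) \sum_(1 <= n < N.+1)
      'C(m + n, n)%:R *: (x (m + n - 1)%N * d m (d n f)).

Lemma d_natM k n f : d k (n%:R * f) = n%:R * d k f.
Proof. by rewrite !mulr_natl linearMn. Qed.

Lemma d_zvarM k p f : (0 < k)%N ->
  d k (zvar p * f) = (if k == p.+1 then p.+1`!%:R * f else 0) + zvar p * d k f.
Proof.
move=> k0; rewrite /zvar -mulrA d_natM dxM // mulrDr mulrA.
by case: eqP => // _; rewrite mulr0.
Qed.

Lemma contract_zvarM N p q f : (q < N)%N ->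
  contract N p (zvar q * f) =
  (p + q + 2)%:R * (zvar (p + q) * f) + zvar q * contract N p f.
Proof.
move=> qN; rewrite /contract.
under eq_big_nat => m /andP[m1 _] do rewrite d_zvarM // !mulrDr.
rewrite big_split /= mulrDr; congr (_ + _); last first.
  rewrite mulrCA; congr (_ * _); rewrite big_distrr /=.
  by apply: eq_bigr => m _; ring.
have qin : q.+1 \in index_iota 1 N.+1 by rewrite mem_index_iota; lia.
rewrite (bigD1_seq q.+1 qin (iota_uniq _ _)) /=.
rewrite big1 ?addr0 => [|m neq]; last by rewrite (negPf neq) !mulr0.
rewrite eqxx /zvar.
(* The factorials in the z_p turn the binomial weight into the linear factor p + q + 2. *)
have factE : ((p + q + 2) * (p + q).+1`! = 'C(q.+1 + p.+1, p.+1) * (p.+1`! * q.+1`!))%N.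
  rewrite -[in X in (_ * (_ * X))%N](addnK p.+1 q.+1) bin_fact; last by lia.
  have -> : (q.+1 + p.+1 = (p + q).+2)%N by lia.
  by rewrite [RHS]factS addn2.
have {}factE : (p + q + 2)%:R * (p + q).+1`!%:R =
    'C(q.+1 + p.+1, p.+1)%:R * (p.+1`!%:R * q.+1`!%:R) :> A.
  by rewrite -!natrM factE.
have -> : (q.+1 + p = (p + q).+1)%N by lia.
by rewrite !mulrA factE; ring.
Qed.

(** Since z_p is linear, at most one of the two derivatives falls on it. The two cross terms,
    [E m n] and [E n m], have the same sum over m and n, which cancels the factor 1/2; the first
    order part meets z_p only for p = 0. *)
Lemma lap_zvarM g N p f : (p < N)%N ->
  lap g N (zvar p * f) =
  zvar p * lap g N f - (if p == 0%N then g%:R * f else 0) + contract N p f.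
Proof.
move=> pN; pose c : A := p.+1`!%:R.
pose F m n f := 'C(m + n, n)%:R *: (x (m + n - 1)%N * d m (d n f)).
pose G m := 'C(m + p.+1, p.+1)%:R * (x (m + p)%N * d m f).
pose E m n : A := if n == p.+1 then c * G m else 0.
have FE m n : (0 < m)%N -> (0 < n)%N ->
    F m n (zvar p * f) = E m n + E n m + zvar p * F m n f.
  move=> m0 n0; rewrite /F !scaler_natl d_zvarM // linearD /= d_zvarM //.
  rewrite !mulrDr addrA; congr (_ + _ + _); last by ring.
    rewrite /E /G; case: eqP => [->|_]; last by rewrite linear0 !mulr0.
    rewrite d_natM addnS subn1 /=.
    by rewrite -/c; ring.
  rewrite /E /G; case: eqP => [->|_]; last by rewrite !mulr0.
  rewrite -bin_sub ?leq_addl // addnK [(p.+1 + n)%N]addnC addnS subn1 /c /=.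
  by ring.
have EM : \sum_(1 <= m < N.+1) \sum_(1 <= n < N.+1) E m n = contract N p f.
  rewrite /contract big_distrr; apply: eq_bigr => m _.
  have pin : p.+1 \in index_iota 1 N.+1 by rewrite mem_index_iota; lia.
  rewrite (bigD1_seq p.+1 pin (iota_uniq _ _)) /=.
  by rewrite big1 ?addr0 /E ?eqxx => // n /negPf ->.
have -> : lap g N (zvar p * f) =
    - (g%:R *: d 1%N (zvar p * f)) + 2%:R^-1 *: (contract N p f + contract N p f +
    zvar p * \sum_(1 <= m < N.+1) \sum_(1 <= n < N.+1) F m n f).
  congr (_ + _ *: _).
  rewrite -[in X in contract N p f + X]EM [in X in _ + X + _]exchange_big.
  rewrite -EM -big_split big_distrr -big_split; apply: eq_big_nat => m /andP[m0 _].
  rewrite -big_split big_distrr -big_split; apply: eq_big_nat => n /andP[n0 _].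
  exact: FE.
have half (h : A) : 2%:R^-1 *: (h + h) = h.
  by rewrite -[X in X + X]scale1r -scalerDl scalerA mulVf // scale1r.
rewrite d_zvarM // eqSS [0%N == p]eq_sym [2%:R^-1 *: (_ + _)]scalerDr half /lap.
rewrite mulrDr mulrN -!scalerAr !scaler_natl.
case: (eqVneq p 0%N) => [p0|_]; last by ring.
have -> : p.+1`!%:R = 1 :> A by rewrite p0.
by ring.
Qed.

End Operators.

(** * Descent in the degree *)

Section Relations.

Variables (A : comAlgType rat) (V : lmodType rat) (cl : {linear A -> V}).
Variables (g : nat) (z : nat -> A) (D : A -> A) (B : nat -> A -> A).

Hypothesis D1 : D 1 = 0.
Hypothesis B1 : forall p, B p 1 = 0.
Hypothesis D_zM : forall p f,
  D (z p * f) = z p * D f - (if p == 0%N then g%:R * f else 0) + B p f.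
Hypothesis B_zM : forall p q f,
  B p (z q * f) = (p + q + 2)%:R * (z (p + q) * f) + z q * B p f.
Hypothesis cl_D : forall f, cl f = 0 -> cl (D f) = 0.

Definition zprod (s : seq nat) : A := \prod_(p <- s) z p.

Lemma zprod_nil : zprod [::] = 1. Proof. exact: big_nil. Qed.

Lemma zprod_cons p s : zprod (p :: s) = z p * zprod s.
Proof. exact: big_cons. Qed.

Lemma zprod_nseq0 r s : zprod (nseq r 0%N ++ s) = z 0 ^+ r * zprod s.
Proof. by rewrite /zprod big_cat big_nseq iter_mulr_1. Qed.

Definition pos (s : seq nat) := all (leq 1) s.

Lemma zprod_pos s :
  zprod s = z 0 ^+ (count_mem 0%N s) * zprod [seq p <- s | (0 < p)%N].
Proof.
elim: s => [|[|p] s IHs] /=; first by rewrite mul1r.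
  by rewrite zprod_cons IHs add1n exprS mulrA.
by rewrite !zprod_cons IHs mulrCA.
Qed.

Lemma cl_natM n f : cl (n%:R * f) = n%:R *: cl f.
Proof. by rewrite mulr_natl raddfMn scaler_nat. Qed.

Lemma B0_zprod s : B 0 (zprod s) = (sumn s + 2 * size s)%:R * zprod s.
Proof.
elim: s => [|p s IHs]; first by rewrite zprod_nil B1 mul0r.
by rewrite zprod_cons B_zM IHs /=; ring.
Qed.

(** Moving one z_0 through D costs -g plus the B_0 eigenvalue of the factors behind it; this
    eigenvalue grows by 2 with each z_0, and the progression of r + 1 terms sums to the
    coefficient. *)
Lemma D_z0X r s :
  D (z 0 ^+ r.+1 * zprod s) =
  (r.+1%:R * ((sumn s + 2 * size s + r)%:R - g%:R)) * (z 0 ^+ r * zprod s)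
  + z 0 ^+ r.+1 * D (zprod s).
Proof.
elim: r => [|r IHr].
  by rewrite expr1 D_zM eqxx B0_zprod; ring.
rewrite exprS -mulrA D_zM IHr eqxx -!zprod_nseq0 B0_zprod !zprod_nseq0.
rewrite sumn_cat sumn_nseq size_cat size_nseq.
by rewrite exprS; ring.
Qed.

Variables (e j : nat).
Hypothesis ge : g = (j + e)%N.
Hypothesis j0 : (0 < j)%N.

(** The list holds the indices p of the factors z_p: its size is the degree, its sum the level. With
    [cl] the projection to R/I, the products in question lie in I. *)
Definition killed (d : nat) :=
  forall s, size s = d -> sumn s = j -> cl (zprod s) = 0.

Lemma killed_rel d r s : killed d -> (size s + r.+1)%N = d -> sumn s = j ->
  (r.+1%:R * ((2 * size s + r)%:R - e%:R)) *: cl (z 0 ^+ r * zprod s)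
  = - cl (z 0 ^+ r.+1 * D (zprod s)).
Proof.
move=> kd sd sj; apply/eqP; rewrite -addr_eq0; apply/eqP.
have /cl_D : cl (z 0 ^+ r.+1 * zprod s) = 0.
  rewrite -zprod_nseq0; apply: kd; first by rewrite size_cat size_nseq; lia.
  by rewrite sumn_cat sumn_nseq sj; lia.
rewrite D_z0X raddfD /= => <-; congr (_ + _); rewrite -linearZ /=; congr (cl _).
by rewrite sj ge -scalerA scalerBl !scaler_natl; ring.
Qed.

Lemma killed_D d s : killed d -> size s = d -> sumn s = j -> cl (D (zprod s)) = 0.
Proof. by move=> kd sd sj; apply: cl_D; apply: kd. Qed.

Lemma killed_pos d :
  (forall r s, pos s -> (size s + r)%N = d -> sumn s = j ->
     cl (z 0 ^+ r * zprod s) = 0) ->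
  killed d.
Proof.
move=> H s sd sj; rewrite zprod_pos; apply: H; first exact: filter_all.
  rewrite -sd size_filter addnC -(count_predC (pred1 0%N)); congr addn.
  by apply: eq_count => p /=; rewrite lt0n.
by rewrite -sj; elim: s {sd sj} => // -[|p] s /= -> .
Qed.

(** All merged products have class t, so only the coefficients p + b + 2, summed over the entries b
    of s, matter. The factor a carries along the entries already passed. *)
Lemma B_const a p s t : (0 < p)%N -> pos s ->
    (forall q, pos q -> size q = size s -> sumn q = (p + sumn s)%N ->
       cl (a * zprod q) = t) ->
  cl (a * B p (zprod s)) = (size s * (p + 2) + sumn s)%:R *: t.
Proof.
move=> p0; elim: s a => [|b s IHs] a /=.
  by rewrite zprod_nil B1 mulr0 linear0 scale0r.
case/andP=> b0 ps H; rewrite zprod_cons B_zM mulrDr raddfD /=.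
have -> : a * ((p + b + 2)%:R * (z (p + b) * zprod s)) =
    (p + b + 2)%:R * (a * zprod (p + b :: s)) by rewrite zprod_cons; ring.
rewrite cl_natM (H (p + b :: s)%N) /=; first last.
- by rewrite addnA.
- by [].
- by rewrite addn_gt0 p0.
rewrite mulrA IHs // => [|q pq sq sumq]; last first.
  rewrite -mulrA -zprod_cons; apply: H => /=; rewrite ?b0 ?sq ?sumq //.
  by rewrite addnCA.
by rewrite -scalerDl -natrD; congr (_%:R *: _); lia.
Qed.

(** With all entries positive D only merges pairs; p + q + 2 summed over the pairs of n entries is
    (n - 1)(sum + n). *)
Lemma D_const a s t : pos s ->
    (forall q, pos q -> (size q).+1 = size s -> sumn q = sumn s ->
       cl (a * zprod q) = t) ->
  cl (a * D (zprod s)) = ((size s).-1 * (sumn s + size s))%:R *: t.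
Proof.
elim: s a => [|p s IHs] a /=.
  by rewrite zprod_nil D1 mulr0 linear0 scale0r.
case/andP=> p0 ps H; rewrite zprod_cons D_zM (gtn_eqF p0) subr0 mulrDr raddfD /=.
rewrite (B_const p0 ps (t := t)) => [|q pq sq sumq]; last by apply: H; rewrite ?sq.
rewrite mulrA IHs // => [|q pq sq sumq]; last first.
  rewrite -mulrA -zprod_cons; apply: H => /=; rewrite ?p0 ?sq ?sumq //.
rewrite -scalerDl -natrD; congr (_%:R *: _).
by case: s {ps IHs H} => [//|b s] /=; ring.
Qed.

(** Induction on the number s of positive factors: merging a pair trades one of them for a z_0,
    which lowers 2s + r, so the right side of [killed_rel] vanishes while its coefficient is
    nonzero. *)
Lemma killed_low d r s : killed d -> pos s -> (size s + r.+1)%N = d ->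
  sumn s = j -> (2 * size s + r < e)%N -> cl (z 0 ^+ r * zprod s) = 0.
Proof.
move=> kd; move Dn: (size s) => n; elim: n r s Dn => [|n IHn] r s sn ps sd sj lt.
  by move: j0; rewrite -sj (size0nil sn).
have := killed_rel kd (etrans (congr1 (addn^~ _) sn) sd) sj.
rewrite (D_const (t := 0)) // => [|q pq sq sumq]; last first.
  by apply: IHn => //; [case: sq; lia|lia|lia|lia].
rewrite scaler0 oppr0 => /eqP; rewrite scaler_eq0 mulf_eq0 pnatr_eq0 /= subr_eq0.
by rewrite eqr_nat sn; case: eqP => [|_ /eqP //]; lia.
Qed.

(** For n positive factors r = e - 1 - n, so the coefficient 2n + r - e = n - 1 vanishes only at n =
    1. Every product of degree e - 1 is thus a nonzero multiple of [t]; D of a product of e positive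
    factors then shows t = 0. *)
Lemma killed_top : (1 < e)%N -> (e <= j)%N -> killed e -> killed e.-1.
Proof.
move=> e1 ej ke; pose t := cl (z 0 ^+ (e - 2) * zprod [:: j]).
have K n : (0 < n < e)%N -> exists2 k : rat, k != 0 &
    forall r s, pos s -> size s = n -> (n + r.+1)%N = e -> sumn s = j ->
      cl (z 0 ^+ r * zprod s) = k *: t.
  elim: n => // -[|n] IHn /andP[_ lt].
    exists 1; rewrite ?oner_eq0 // => r [|p []] //= _ _ re; rewrite addn0 => ->.
    by rewrite scale1r /t; congr (cl (z 0 ^+ _ * _)); lia.
  have [|k k0 Hk] := IHn; first by lia.
  have c0 : (e - n.+2)%:R * n.+1%:R != 0 :> rat.
    by rewrite mulf_neq0 ?pnatr_eq0; lia.
  exists (- ((e - n.+2)%:R * n.+1%:R)^-1 * (n.+1 * (j + n.+2))%:R * k).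
    by rewrite !(mulf_neq0, oppr_eq0, invr_eq0) // pnatr_eq0; lia.
  move=> r s ps sn re sj.
  have := killed_rel ke (etrans (congr1 (addn^~ _) sn) re) sj.
  rewrite (D_const (t := k *: t)) // => [|q pq sq sumq]; last first.
    by apply: Hk => //; lia.
  rewrite sn sj /= => E.
  have cE : r.+1%:R * ((2 * n.+2 + r)%:R - e%:R) = (e - n.+2)%:R * n.+1%:R :> rat.
    by rewrite -re addKn -natrB; [congr (_ * _%:R); lia|lia].
  apply: (scalerI c0); rewrite -[in LHS]cE E !scalerA -scaleNr; congr (_ *: _).
  by rewrite !mulrA mulrN divff // mulN1r mulNr.
have [|k k0 Hk] := K e.-1; first by lia.
have t0 : t = 0.
  (* The hypothesis e <= j is what allows e positive indices of sum j. *)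
  pose s := (j - e.-1 :: nseq e.-1 1)%N.
  have ss : size s = e by rewrite /= size_nseq; lia.
  have sj : sumn s = j by rewrite /= sumn_nseq; lia.
  have ps : pos s by rewrite /pos /= all_nseq orbT andbT; lia.
  have := killed_D ke ss sj; rewrite -[D _]mul1r (D_const (t := k *: t)) //.
    rewrite ss sj => /eqP; rewrite !scaler_eq0 (negPf k0) pnatr_eq0 muln_eq0.
    by case: eqP => [|_]; [lia|case: eqP => [|_ /eqP]; [lia|]].
  move=> q pq sq sumq; rewrite -(expr0 (z 0)); apply: Hk => //; lia.
apply: killed_pos => r s ps sd sj.
case: (size s =P 0%N) => s0; first by move: j0; rewrite -sj (size0nil s0).
have [|k' _ Hk'] := K (size s); first by lia.
by rewrite (Hk' r s) ?t0 ?scaler0 //; lia.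
Qed.

(** For s positive factors and r = d - s, 2s + r = s + d <= 2d < e, so [killed_low] covers every
    product. *)
Lemma killed_down d : (2 * d < e)%N -> killed d.+1 -> killed d.
Proof.
move=> de kd; apply: killed_pos => r s ps sd sj.
by apply: (killed_low kd) => //; lia.
Qed.

(** * The cases e = 4 and e = 5 *)

Lemma D_zprod3 a b c : (0 < a)%N -> (0 < b)%N -> (0 < c)%N ->
  D (zprod [:: a; b; c]) =
  (a + b + 2)%:R * zprod [:: a + b; c]%N + (a + c + 2)%:R * zprod [:: a + c; b]%N
  + (b + c + 2)%:R * zprod [:: b + c; a]%N.
Proof.
move=> a0 b0 c0; rewrite !zprod_cons zprod_nil !D_zM !B_zM !B1 D1.
by rewrite !gtn_eqF //; ring.
Qed.

Lemma D_zprod4 a b c d : (0 < a)%N -> (0 < b)%N -> (0 < c)%N -> (0 < d)%N ->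
  D (zprod [:: a; b; c; d]) =
  (a + b + 2)%:R * zprod [:: a + b; c; d]%N + (a + c + 2)%:R * zprod [:: a + c; b; d]%N
  + (a + d + 2)%:R * zprod [:: a + d; b; c]%N + (b + c + 2)%:R * zprod [:: b + c; a; d]%N
  + (b + d + 2)%:R * zprod [:: b + d; a; c]%N + (c + d + 2)%:R * zprod [:: c + d; a; b]%N.
Proof.
move=> a0 b0 c0 d0; rewrite !zprod_cons zprod_nil !D_zM !B_zM !B1 D1.
by rewrite !gtn_eqF //; ring.
Qed.

Lemma zprod_swap a b : zprod [:: a; b] = zprod [:: b; a].
Proof. by rewrite !zprod_cons mulrCA. Qed.

Lemma killed_all4 : e = 4%N -> (4 < j)%N -> killed 4 -> forall d, (d < 4)%N -> killed d.
Proof.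
move=> e4 j4 k4.
have k3 : killed 3 by have := killed_top; rewrite e4 => /(_ isT (ltnW j4) k4) /=.
pose f k := cl (zprod [:: k; j - k]%N).
(* For two positive factors and no z_0 the coefficient 2s + r - e vanishes; the relations come
   instead from D on three positive factors. *)
have f0 c : (0 < c < j)%N -> f c = 0.
  apply: three_part_vanish => // [k kj|a b d a0 b0 d0 abd].
    by rewrite /f zprod_swap subKn //; lia.
  apply: etrans (killed_D k3 (s := [:: a; b; d]) erefl _); last by rewrite /= addn0 addnA.
  rewrite D_zprod3 // !linearD /= !cl_natM /merge3 /f.
  have -> : (j - (a + b) = d)%N by lia.
  have -> : (j - (a + d) = b)%N by lia.
  by have -> : (j - (b + d) = a)%N by lia.
have k2 : killed 2.
  apply: killed_pos => r [|a [|b [|? ?]]] ps sr sj.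
  - by move: j0; rewrite -sj.
  - by apply: (killed_low k3) => //; move: sr => /=; lia.
  - have -> : r = 0%N by move: sr => /=; lia.
    rewrite expr0 mul1r; move: ps sj => /= /and3P[a0 b0 _] sj.
    have -> : b = (j - a)%N by lia.
    by apply: f0; lia.
  by move: sr => /=; lia.
have k1 : killed 1 by apply: killed_down k2; lia.
have k0 : killed 0 by apply: killed_down k1; lia.
by case=> [|[|[|[|]]]].
Qed.

Lemma killed_all5 : e = 5%N -> (6 < j)%N -> killed 5 -> forall d, (d < 5)%N -> killed d.
Proof.
move=> e5 j6 k5.
have k4 : killed 4 by have := killed_top; rewrite e5 => /(_ isT (ltnW (ltnW j6)) k5) /=.
pose f k := cl (z 0 * zprod [:: k; j - k]%N).
(* With s = 3, r = 0, e = 5 the coefficient in [killed_rel] is 1, so three positive factors reduce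
   to z_0 times two. *)
have k4D a b c : (0 < a)%N -> (0 < b)%N -> (0 < c)%N -> (a + b + c)%N = j ->
    cl (zprod [:: a; b; c]) = - merge3 f a b c.
  move=> a0 b0 c0 abc.
  have := @killed_rel 4 0 [:: a; b; c] k4 erefl; rewrite /= addn0 addnA => /(_ abc).
  rewrite e5 expr0 expr1 mul1r (_ : 1 * _ = 1) // scale1r => ->; congr (- _).
  rewrite D_zprod3 // !mulrDr !linearD /= ![z 0 * (_%:R * _)]mulrCA !cl_natM /merge3 /f.
  have -> : (j - (a + b) = c)%N by lia.
  have -> : (j - (a + c) = b)%N by lia.
  by have -> : (j - (b + c) = a)%N by lia.
(* D on four positive factors, rewritten by [k4D], undergoes a second merge and becomes
   -[merge4]. *)
have f0 c : (0 < c < j)%N -> f c = 0.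
  apply: four_part_vanish => // [k kj|a b d h a0 b0 d0 h0 abdh].
    by rewrite /f zprod_swap subKn //; lia.
  apply: oppr_inj; rewrite oppr0.
  apply: etrans (killed_D k4 (s := [:: a; b; d; h]) erefl _); last first.
    by rewrite /= addn0 !addnA.
  rewrite D_zprod4 // ![in RHS]linearD /= !cl_natM /merge4 !opprD -!scalerN.
  by rewrite !k4D ?addn_gt0 ?a0 ?b0 ?d0 ?h0 //; lia.
have k3 : killed 3.
  apply: killed_pos => r [|a [|b [|c [|? ?]]]] ps sr sj.
  - by move: j0; rewrite -sj.
  - by apply: (killed_low k4) => //; move: sr => /=; lia.
  - have -> : r = 1%N by move: sr => /=; lia.
    rewrite expr1; move: ps sj => /= /and3P[a0 b0 _] sj.
    have -> : b = (j - a)%N by lia.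
    by apply: f0; lia.
  - have -> : r = 0%N by move: sr => /=; lia.
    rewrite expr0 mul1r; move: ps sj => /= /and4P[a0 b0 c0 _] sj.
    rewrite k4D //; last by lia.
    by rewrite /merge3 !f0 ?scaler0 ?addr0 ?oppr0 //; lia.
  by move: sr => /=; lia.
have k2 : killed 2 by apply: killed_down k3; lia.
have k1 : killed 1 by apply: killed_down k2; lia.
have k0 : killed 0 by apply: killed_down k1; lia.
by case=> [|[|[|[|[|]]]]].
Qed.

End Relations.

(** * The polynomial ring *)

Local Notation wt h u := (\sum_(i <- finsupp u) u i * h i)%N.

Lemma wt_sub (h : nat -> nat) (u : monom) (d : {fset nat}) :
  finsupp u `<=` d -> wt h u = (\sum_(i <- d) u i * h i)%N.
Proof.
move=> sub; apply: big_fset_incl => // i _; rewrite -cmE_eq0 => /eqP ->.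
by rewrite mul0n.
Qed.

Lemma wtM (h : nat -> nat) (u v : monom) :
  wt h (mulcm u v) = (wt h u + wt h v)%N.
Proof.
rewrite (@wt_sub h u (finsupp u `|` finsupp v)) ?fsubsetUl //.
rewrite (@wt_sub h v (finsupp u `|` finsupp v)) ?fsubsetUr //.
rewrite (mdomD u v) -big_split /=; apply: eq_bigr => i _.
by rewrite mulcmE mulnDl.
Qed.

Lemma wtU (h : nat -> nat) (i : nat) : wt h (ucm i) = h i.
Proof. by rewrite (mdomU i) big_seq_fset1 (cmUU i) mul1n. Qed.

Lemma mulUdiv (u : monom) (i : nat) :
  u i != 0%N -> mulcm (ucm i) (divcm u (ucm i)) = u.
Proof.
move=> ui; apply/eqP/cmP => k; rewrite mulcmE divcmE ucmE.
by case: (eqVneq i k) => [<-|_] /=; rewrite ?subn0 // subnKC ?lt0n.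
Qed.

Lemma mulcm_inj (u : monom) : injective (mulcm u).
Proof.
move=> v w /eqP/cmP e; apply/eqP/cmP => k; have := e k.
by rewrite !mulcmE => /addnI.
Qed.

Lemma mcoeff_pd k (f : PR) (v : monom) :
  (pd k f)@_v = f@_(mulcm (ucm k.-1) v) * (v k.-1).+1%:R.
Proof.
rewrite /pd raddf_sum /=; set e := ucm _.
have ek : e k.-1 = 1%N by rewrite /e (cmUU k.-1).
have vk : (mulcm e v) k.-1 = (v k.-1).+1 by rewrite mulcmE ek.
have div_ev : divcm (mulcm e v) e = v.
  by apply/eqP/cmP => i; rewrite divcmE mulcmE addKn.
have F0 (u : monom) : u != mulcm e v ->
    << f@_u * (u k.-1)%:R *g divcm u e >>@_v = 0.
  move=> neq; rewrite mcoeffU; case: eqP => [eq|//]; rewrite mulr1n.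
  (* Division truncates, so a monomial free of x_k may be sent to v, but then with coefficient 0. *)
  have [->|uk] := eqVneq (u k.-1) 0%N; first by rewrite mulr0.
  by rewrite -eq mulUdiv ?eqxx in neq.
have [inf|ninf] := boolP (mulcm e v \in msupp f).
  rewrite (bigD1_seq (mulcm e v) inf (fset_uniq _)) big1; last by move=> u /F0.
  by apply: (etrans (addr0 _)); rewrite mcoeffU div_ev eqxx mulr1n vk.
rewrite (mcoeff_outdom ninf) mul0r big1_seq // => u /andP[_ uf].
by apply: F0; apply: contraNneq ninf => <-.
Qed.

(* Sealed copies of the coefficient function, the variables and the partial
   derivatives: unification on the unsealed ones diverges. *)
Fact opaque_key : unit. Proof. exact: tt. Qed.
Definition cf : PR -> monom -> rat :=
  locked_with opaque_key (fun f u => f@_u).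
Definition vx : nat -> PR := locked_with opaque_key X.
Definition dx : nat -> PR -> PR := locked_with opaque_key pd.

Lemma cfP (f h : PR) : (forall u, cf f u = cf h u) -> f = h.
Proof. by rewrite /cf unlock => fh; apply/malgP. Qed.

Lemma cfD (f h : PR) u : cf (f + h) u = cf f u + cf h u.
Proof. by rewrite /cf unlock; exact: mcoeffD. Qed.

Lemma cfZ a (f : PR) u : cf (a *: f) u = a * cf f u.
Proof. by rewrite /cf unlock; exact: mcoeffZ. Qed.

Lemma cf_dx k f v : cf (dx k f) v = cf f (mulcm (ucm k.-1) v) * (v k.-1).+1%:R.
Proof. by rewrite /cf /dx !unlock; exact: mcoeff_pd. Qed.

Fact dx_linear k : linear (dx k).
Proof.
move=> a f h; apply: cfP => v; rewrite !(cf_dx, cfD, cfZ).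
by rewrite mulrDl mulrA.
Qed.

HB.instance Definition _ k :=
  GRing.isLinear.Build rat PR PR *:%R (dx k) (dx_linear k).

Lemma cf_XM i (f : PR) (v : monom) :
  cf (vx i * f) v = if v i.-1 == 0%N then 0 else cf f (divcm v (ucm i.-1)).
Proof.
rewrite /cf /vx !unlock /X malgM_def fgmulUg raddf_sum /=; set e := ucm _.
have ei : e i.-1 = 1%N by rewrite /e (cmUU i.-1).
case: ifP => [/eqP vi|/negbT vi].
  rewrite big1_seq // => u _; rewrite mcoeffU; case: eqP => // eq.
  by have /eqP/cmP/(_ i.-1) := eq; rewrite (cmM i.-1) ei vi.
set w := divcm v e; have ev : mmul e w = v by exact: mulUdiv.
have F0 (u : monom) : u != w -> << 1 * f@_u *g mmul e u >>@_v = 0.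
  move=> neq; rewrite mcoeffU -ev; case: eqP => // /mulcm_inj eq.
  by rewrite eq eqxx in neq.
have [inf|ninf] := boolP (w \in msupp f).
  rewrite (bigD1_seq w inf (fset_uniq _)) big1 => [|u /F0 //].
  by apply: (etrans (addr0 _)); rewrite mcoeffU ev eqxx mulr1n mul1r.
rewrite (mcoeff_outdom ninf) big1_seq // => u /andP[_ uf].
by apply: F0; apply: contraNneq ninf => <-.
Qed.

Lemma dx_XM k i (f : PR) : (0 < k)%N -> (0 < i)%N ->
  dx k (vx i * f) = (if k == i then f else 0) + vx i * dx k f.
Proof.
case: k i => // k [] // i _ _; rewrite eqSS.
apply: cfP => v; rewrite cf_dx (cf_XM i.+1 f) cfD (cf_XM i.+1 (dx k.+1 f)) cf_dx.
rewrite mulcmE ucmE /=; have [<-|neq] := eqVneq k i.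
  rewrite addn_eq0 /=.
  have -> : divcm (mulcm (ucm k) v) (ucm k) = v.
    by apply/eqP/cmP => m; rewrite divcmE mulcmE addKn.
  have [->|vk] := eqVneq (v k) 0%N; first by rewrite mulr1 addr0.
  rewrite mulUdiv // divcmE (cmUU k).
  by rewrite subn1 prednK ?lt0n// -natr1 mulrDr mulr1 addrC.
rewrite add0n; have -> : cf 0 v = 0 by rewrite -(scale0r (0 : PR)) cfZ mul0r.
rewrite add0r; have [_|vi] := eqVneq (v i) 0%N; first by rewrite mul0r.
congr (_ * _); last by rewrite divcmE ucmE [i == k]eq_sym (negPf neq) subn0.
congr (cf _ _); apply/eqP/cmP => m; rewrite !(divcmE, mulcmE, ucmE).
case: (eqVneq i m) => [<-|_] /=; last by rewrite !subn0.
by rewrite addnBA // lt0n.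
Qed.

Lemma dx_1 k : dx k 1 = 0.
Proof.
apply: cfP => v; rewrite cf_dx /cf unlock mcoeff1 mcoeff0.
case: eqP => [/eqP/cmP/(_ k.-1)|_]; last by rewrite mul0r.
by rewrite mulcmE (cmUU k.-1) cm1.
Qed.

Lemma dx_eq0 (k : nat) (f : PR) : (nvars f < k)%N -> dx k f = 0.
Proof. by rewrite /dx unlock; exact: pd_eq0. Qed.

Lemma dx_comm m n f : dx m (dx n f) = dx n (dx m f).
Proof.
apply: cfP => v; rewrite !cf_dx !mulcmE !ucmE.
case: (eqVneq m.-1 n.-1) => [->//|mn].
rewrite mulcmA [mulcm (ucm n.-1) _]mulcmC mulcmA.
by rewrite -!mulrA [_%:R * _]mulrC.
Qed.

Lemma cls_scalable g : scalable (cls g).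
Proof. by move=> a f; rewrite -cls_scale. Qed.

HB.instance Definition _ g :=
  GRing.isScalable.Build rat PR (calR g) *:%R (cls g) (@cls_scalable g).

(** * The abstract operators on the polynomial ring *)

Lemma dxE : dx = pd. Proof. by rewrite /dx unlock. Qed.

Lemma vxE : vx = X. Proof. by rewrite /vx unlock. Qed.

Definition dxl (k : nat) : {linear PR -> PR} := dx k.

Definition contractPR (p : nat) (f : PR) : PR := contract vx dxl (nvars f) p f.

Lemma contractPRE N p f : (nvars f <= N)%N ->
  contractPR p f = contract vx dxl N p f.
Proof.
move=> le; rewrite /contractPR /contract; congr (_ * _).
rewrite [RHS](@big_cat_nat _ _ _ (nvars f).+1) //=.
rewrite [X in _ + X]big_nat_cond [X in _ + X]big1 ?addr0 // => m /andP[/andP[lt _] _].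
by rewrite dx_eq0 // !mulr0.
Qed.

(** Terms beyond [nvars f] vanish; when it is m that is large, the two derivatives are first
    commuted so that the one in x_m acts on f. *)
Lemma DopE g N f : (nvars f <= N)%N -> Dop g f = lap vx dxl g N f.
Proof.
move=> le.
pose F m n := 'C(m + n, n)%:R *: (vx (m + n - 1) * dx m (dx n f)).
have F0 m n : (nvars f < m)%N || (nvars f < n)%N -> F m n = 0.
  rewrite /F; case/orP => lt; last by rewrite (dx_eq0 lt) linear0 mulr0 scaler0.
  by rewrite dx_comm (dx_eq0 lt) linear0 mulr0 scaler0.
have -> : Dop g f = - (g%:R *: dx 1 f)
    + 2%:R^-1 *: \sum_(1 <= m < (nvars f).+1) \sum_(1 <= n < (nvars f).+1) F m n.
  by rewrite /F dxE vxE.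
congr (_ + _ *: _); rewrite [RHS](@big_cat_nat _ _ _ (nvars f).+1) //=.
rewrite [X in _ + X]big_nat_cond [X in _ + X]big1 ?addr0; last first.
  move=> m /andP[/andP[lt _] _]; rewrite big1 // => n _.
  by apply: F0; rewrite lt.
apply: eq_bigr => m _; rewrite [RHS](@big_cat_nat _ _ _ (nvars f).+1) //=.
rewrite [X in _ + X]big_nat_cond [X in _ + X]big1 ?addr0 //.
by move=> n /andP[/andP[lt _] _]; apply: F0; rewrite lt orbT.
Qed.

Local Notation zPR := (zvar vx).

Lemma contractPR1 p : contractPR p 1 = 0.
Proof.
by rewrite /contractPR /contract big1 ?mulr0 // => m _; rewrite /dxl /= dx_1 !mulr0.
Qed.

Lemma Dop1 g : Dop g 1 = 0.
Proof.
rewrite (DopE g (leqnn _)) /lap /dxl /= dx_1 scaler0 oppr0 add0r.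
rewrite big1 ?scaler0 // => m _; rewrite big1 // => n _.
by rewrite dx_1 linear0 mulr0 scaler0.
Qed.

Lemma contractPR_zM p q f :
  contractPR p (zPR q * f) =
  (p + q + 2)%:R * (zPR (p + q) * f) + zPR q * contractPR p f.
Proof.
pose N := maxn (maxn (nvars f) (nvars (zPR q * f))) q.+1.
have [fN zN qN] : [/\ nvars f <= N, nvars (zPR q * f) <= N & q < N]%N.
  by rewrite /N; split; lia.
by rewrite (contractPRE p fN) (contractPRE p zN) (contract_zvarM dx_XM).
Qed.

Lemma Dop_zM g p f :
  Dop g (zPR p * f) =
  zPR p * Dop g f - (if p == 0%N then g%:R * f else 0) + contractPR p f.
Proof.
pose N := maxn (maxn (nvars f) (nvars (zPR p * f))) p.+1.
have [fN zN pN] : [/\ nvars f <= N, nvars (zPR p * f) <= N & p < N]%N.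
  by rewrite /N; split; lia.
by rewrite (DopE g fN) (DopE g zN) (contractPRE p fN) (lap_zvarM dx_XM).
Qed.

(** * Monomials and membership in I *)

Lemma cls_eq0 g f : cls g f = 0 <-> in_I g f.
Proof.
rewrite -(raddf0 (cls g)) cls_eq subr0; split=> [/asboolP //|?].
exact/asboolP.
Qed.

Lemma cls_Dop g f : cls g f = 0 -> cls g (Dop g f) = 0.
Proof.
move=> /cls_eq0 If; apply/cls_eq0 => S sS sD sI.
exact: (sD _ (If S sS sD sI)).
Qed.

Lemma monalgUU (a b : rat) (u v : monom) :
  << a *g u >> * << b *g v >> = << a * b *g mulcm u v >> :> PR.
Proof. by rewrite malgM_def fgmulUU. Qed.

Lemma scale_monalgU (a b : rat) (u : monom) :
  a *: << b *g u >> = << a * b *g u >> :> PR.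
Proof.
apply: (etrans (esym (mul_malgC _ _))); apply: (etrans (monalgUU _ _ _ _)).
exact: (congr1 (fun v => << a * b *g v >>) (mul0cm u)).
Qed.

Lemma zPR_U p : zPR p = << p.+1`!%:R *g ucm p >>.
Proof.
by rewrite /zvar vxE /X mulr_natl -monalgUMn.
Qed.

Lemma zprod_U s : exists (a : rat) (u : monom),
  [/\ zprod zPR s = << a *g u >>, codim u = (sumn s + size s)%N & level u = sumn s].
Proof.
elim: s => [|p s [a [u [zs cu lu]]]].
  exists 1, (onecm nat).
  by rewrite zprod_nil /codim /level (mdom1 : finsupp (onecm nat) = fset0) !big_seq_fset0.
exists (p.+1`!%:R * a), (mulcm (ucm p) u); split.
- by rewrite zprod_cons zs zPR_U; exact: monalgUU.
- by rewrite /codim wtM wtU -/(codim u) cu /=; lia.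
by rewrite /level wtM wtU -/(level u) lu.
Qed.

(** The factorials are nonzero rationals, so killing the products of the z_p kills the monomials of
    the same level. *)
Lemma monom_zprod (u : monom) : exists2 a : rat, a != 0 &
  exists2 s, sumn s = level u & zprod zPR s = << a *g u >>.
Proof.
(* Induction on the codimension, not the level: dividing by x_1 leaves the level unchanged. *)
have [n le_n] := ubnP (codim u); elim: n u le_n => // n IHn u le_n.
have [u0|[i iu]] := fset_0Vmem (finsupp u).
  have -> : u = onecm nat.
    by apply/eqP/cmP => k; apply/eqP; rewrite onecmE cmE_eq0 u0.
  exists 1; rewrite ?oner_eq0 //; exists [::]; last exact: zprod_nil.
  by rewrite /level (mdom1 : finsupp (onecm nat) = fset0) big_seq_fset0.
pose w := divcm u (ucm i); have uE : mulcm (ucm i) w = u.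
  by apply: mulUdiv; rewrite cmE_neq0.
have [|a a0 [s sw zs]] := IHn w.
  by move: le_n; rewrite -uE /codim wtM wtU -/(codim w); lia.
exists (i.+1`!%:R * a); first by rewrite mulf_neq0 // pnatr_eq0 -lt0n fact_gt0.
exists (i :: s); first by rewrite -uE /level wtM wtU -/(level w) -sw.
by rewrite zprod_cons zs zPR_U -[in RHS]uE; exact: monalgUU.
Qed.

Lemma monspan_sum (P : pred monom) g (f : PR) :
  (forall u a, P u -> cls g << a *g u >> = 0) -> monspan P f -> cls g f = 0.
Proof.
move=> H Pf; rewrite (monalgE f) raddf_sum big1_seq // => u /andP[_ uf].
exact/H/Pf.
Qed.

Lemma monspanU (P : pred monom) (a : rat) u : P u -> monspan P << a *g u >>.
Proof. by move=> Pu w /(fsubsetP msuppU_le); rewrite in_fset1 => /eqP ->. Qed.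

Lemma monspan0 (P : pred monom) : monspan P 0.
Proof. by move=> u; rewrite msupp0. Qed.

(** The codimension is j + size s >= g. If it equals g the monomial lies in Fil^1, as its level j is
    positive; otherwise it lies in R^(>g). *)
Lemma cls_zprod_ge g e j s : g = (j + e)%N -> (0 < j)%N ->
  sumn s = j -> (e <= size s)%N -> cls g (zprod zPR s) = 0.
Proof.
move=> gE j0 sj es; have [a [u [-> cu lu]]] := zprod_U s.
apply/cls_eq0 => S sS sD sI; have [eqg|gtg] := eqVneq (codim u) g.
  rewrite -(add0r << _ *g _ >>); apply: sI; first exact: monspan0.
  by apply: monspanU; rewrite /= eqg eqxx lu sj.
rewrite -(addr0 << _ *g _ >>); apply: sI; last exact: monspan0.
by apply: monspanU => /=; move: gtg; rewrite cu sj; lia.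
Qed.

(** The bounds on g are the conditions j = g - 4 > 4 and j = g - 5 > 6 of the two kernel lemmas. *)
Lemma calR_level_eq0 g e (z : calR g) :
    (e = 4 /\ 8 < g \/ e = 5 /\ 11 < g)%N ->
  calR_level (g - e) z -> z = 0.
Proof.
move=> eg [n [t [tb ->]]]; apply: big1 => i _.
have [f ff ->] := tb i (ltn_ord i).
pose j := (g - e)%N; have gE : g = (j + e)%N by rewrite /j; lia.
have j0 : (0 < j)%N by rewrite /j; lia.
have kge d : (e <= d)%N -> killed (cls g) zPR j d.
  by move=> ed s sd sj; apply: (cls_zprod_ge gE j0 sj); rewrite sd.
have klt d : (d < e)%N -> killed (cls g) zPR j d.
  case: eg => -[e45 gg].
    rewrite e45; apply: (killed_all4 (Dop1 g) contractPR1 (Dop_zM g) contractPR_zM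
      (@cls_Dop g) gE j0 e45).
      by rewrite /j; lia.
    by apply: kge; rewrite e45.
  rewrite e45; apply: (killed_all5 (Dop1 g) contractPR1 (Dop_zM g) contractPR_zM
    (@cls_Dop g) gE j0 e45).
    by rewrite /j; lia.
  by apply: kge; rewrite e45.
apply: monspan_sum ff => u a /andP[_ /eqP lu].
have [c c0 [s su zs]] := monom_zprod u.
have -> : << a *g u >> = (a / c) *: << c *g u >> :> PR.
  apply: (etrans _ (esym (scale_monalgU _ _ _))).
  exact: (congr1 (fun x : rat => << x *g u >> : PR) (esym (divfK c0 a))).
apply: (etrans (linearZ_LR _ _ _)); rewrite /= -zs.
suff -> : cls g (zprod zPR s) = 0 by rewrite scaler0.
have sj : sumn s = j by rewrite su lu.
by have [le|lt] := leqP e (size s); [apply: (kge _ le)|apply: (klt _ lt)].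
Qed.

Theorem corollary2p11 (g : nat) (hg : (3 <= g)%N) :
  ((9 <= g)%N -> forall z : calR g, calR_level (g - 4) z -> z = 0%R) /\
  ((12 <= g)%N -> forall z : calR g, calR_level (g - 5) z -> z = 0%R).
Proof.
by split=> gg z; apply: calR_level_eq0; [left|right].
Qed.
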